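(* Up to isomorphism, there are only finitely many 5-vertex-critical $(P_5,\text{chair})$-free graphs.
   Context: All graphs are finite and simple. $P_t$ denotes the path on $t$ vertices. The chair is the 5-vertex graph obtained from a path $P_4$ by adding one new vertex adjacent to exactly one of the two middle vertices of the $P_4$. A graph $G$ is $(H_1,H_2)$-free if it contains no induced subgraph isomorphic to $H_1$ or to $H_2$. A graph $G$ is $k$-vertex-critical if $\chi(G)=k$ and $\chi(G-v)<k$ for every vertex $v\in V(G)$. *)

(* Defs.v *)
From mathcomp Require Import all_boot.
Set Implicit Arguments. Unset Strict Implicit. Unset Printing Implicit Defensive.

Definition simple_graph (T : finType) (e : rel T) : Prop :=
  symmetric e /\ irreflexive e.

Definition path_rel (t : nat) : rel 'I_t :=
  fun i j => (i.+1 == j :> nat) || (j.+1 == i :> nat).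

Definition chair_edge (i j : nat) : bool :=
  [|| (i == 0) && (j == 1), (i == 1) && (j == 2), (i == 2) && (j == 3)
    | (i == 1) && (j == 4)].
Definition chair_rel : rel 'I_5 :=
  fun i j => chair_edge i j || chair_edge j i.

Definition contains_induced (n : nat) (h : rel 'I_n) (T : finType) (e : rel T)
  : Prop :=
  exists f : 'I_n -> T, injective f /\ forall i j, e (f i) (f j) = h i j.

Definition H_free n (h : rel 'I_n) (T : finType) (e : rel T) : Prop :=
  ~ contains_induced h e.

Definition colorable_on (T : finType) (e : rel T) (k : nat) (A : {set T}) : bool :=
  [exists c : {ffun T -> 'I_k},
     [forall x in A, forall y in A, e x y ==> (c x != c y)]].

(* Chromatic number of the subgraph induced on A (for a loopless graph,
   A is always #|A|-colourable, so this is the least k with a proper k-colouring). *)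
Definition chi_on (T : finType) (e : rel T) (A : {set T}) : nat :=
  \big[minn/#|A|]_(k < #|A|.+1 | colorable_on e k A) k.

Definition chi (T : finType) (e : rel T) : nat := chi_on e [set: T].

Definition vertex_critical (k : nat) (T : finType) (e : rel T) : Prop :=
  chi e = k /\ forall v : T, chi_on e [set~ v] < k.

Definition graph_iso (n : nat) (h : rel 'I_n) (T : finType) (e : rel T) : Prop :=
  exists f : 'I_n -> T, bijective f /\ forall i j, e (f i) (f j) = h i j.
Arguments path_rel t : clear implicits.

(* Main.v *)
Require Import Defs.
From mathcomp Require Import all_boot zify.
Set Implicit Arguments. Unset Strict Implicit. Unset Printing Implicit Defensive.

(** Fix a (k+1)-vertex-critical (P5, chair)-free graph, for arbitrary k. If it
is large then it contains many pairwise anticomplete sets of chromatic number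
greater than c, for every c <= k; for c = k, two such sets contradict
criticality. The case c = 0 is a large stable set (a colour class). To pass
from c to c + 1, take a family of connected sets of chromatic number c + 1,
pairwise anticomplete and of maximal total size. A vertex x that is mixed on a
member X i sees at most one other member, because the graph is (P5, chair)-free;
adding x to that member (or to X i, by maximality) raises the chromatic number,
and P5-freeness makes these enlargements essentially disjoint. If instead most
members are homogeneous, criticality makes their neighbourhoods pairwise
incomparable, so the forbidden subgraphs yield pairwise nonadjacent private
neighbours w i for many X i, and w i joined to X i has larger chromatic
number. Each step loses only a constant factor, so the order is bounded. *)

(** * Finiteness of the graphs of bounded order, and a selection lemma *)

Lemma bounded_graphs_finite (n0 : nat) :
  exists (N : nat) (G : nat -> {n : nat & rel 'I_n}),
    forall (T : finType) (e : rel T), #|T| <= n0 ->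
      exists i, i < N /\ graph_iso (projT2 (G i)) e.
Proof.
pose S : finType := {n : 'I_n0.+1 & {ffun 'I_n * 'I_n -> bool}}.
(* The edgeless graph on no vertices serves only as the default value of [nth]. *)
pose g0 : S := Tagged (fun n : 'I_n0.+1 => {ffun 'I_n * 'I_n -> bool})
  ([ffun=> false] : {ffun 'I_(@ord0 n0) * 'I_(@ord0 n0) -> bool}).
exists #|S|, (fun i => let g := nth g0 (enum S) i in
  existT (fun n => rel 'I_n) (tag g : nat) (fun a b => tagged g (a, b))).
move=> T e leT.
pose g : S := Tagged (fun n : 'I_n0.+1 => {ffun 'I_n * 'I_n -> bool})
  (i := Ordinal (leT : #|T| < n0.+1))
  [ffun p : 'I_#|T| * 'I_#|T| => e (enum_val p.1) (enum_val p.2)].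
exists (index g (enum S)).
rewrite cardE index_mem mem_enum nth_index ?mem_enum //; split=> //=.
by exists enum_val; split=> [|i j]; [apply: enum_val_bij | rewrite ffunE].
Qed.

(** Greedy choice in a digraph of out-degree at most [d]: counting arcs in two ways gives a vertex
    of in-degree at most [d]. It is kept, its at most [2 * d] neighbours are deleted, and the
    argument is repeated on the rest. *)
Lemma sparse_selection (I : finType) (r : rel I) (d : nat) (A : {set I}) :
  {in A, forall i, #|[set j in A | r i j]| <= d} ->
  exists B : {set I}, [/\ B \subset A, #|A| <= (2 * d).+1 * #|B|
    & {in B &, forall i j, i != j -> ~~ r i j}].
Proof.
elim/(@ltn_ind): {A}#|A| {-2}A (erefl #|A|) => n IH A cardA outA.
have [->|A0] := eqVneq A set0.
  by exists set0; rewrite cards0 sub0set; split=> // i j; rewrite inE.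
have [i iA inA]: exists2 i, i \in A & #|[set j in A | r j i]| <= d.
  apply/exists_inP; apply: contraT; rewrite negb_exists_in => /forall_inP big.
  have: \sum_(i in A) d.+1 <= \sum_(j in A) d.
    have le2 : \sum_(j in A) #|[set i in A | r j i]| <= \sum_(j in A) d.
      exact: leq_sum outA.
    have le1 : \sum_(i in A) d.+1 <= \sum_(i in A) #|[set j in A | r j i]|.
      by apply: leq_sum => i /big; rewrite -ltnNge.
    apply: leq_trans le1 (leq_trans _ le2); rewrite leq_eqVlt; apply/orP; left.
    under eq_bigr => i _ do rewrite -sum1dep_card big_mkcondr.
    rewrite exchange_big; apply/eqP/eq_bigr => i _.
    by rewrite -sum1dep_card big_mkcondr.
  rewrite !sum_nat_const leq_mul2l ltnn orbF cards_eq0.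
  by rewrite (negPf A0).
pose D := i |: ([set j in A | r i j] :|: [set j in A | r j i]).
have cardD : #|D| <= (2 * d).+1.
  apply: (leq_trans (leq_card_setU _ _)); rewrite cards1 add1n ltnS mul2n -addnn.
  by apply: (leq_trans (leq_card_setU _ _)); rewrite leq_add ?outA.
have DA : D \subset A.
  by apply/subsetP => j; rewrite !inE => /or3P[/eqP->//|/andP[]//|/andP[]].
have cardAD : #|A| = #|D| + #|A :\: D|.
  by rewrite -(cardsID D A) (setIidPr DA).
have [||B [BA cardB indB]] := IH #|A :\: D| _ (A :\: D) erefl.
- have : 0 < #|D| by apply/card_gt0P; exists i; rewrite !inE eqxx.
  lia.
- move=> j /setDP[jA _]; apply: leq_trans (outA j jA).
  by apply/subset_leq_card/subsetP => l; rewrite !inE => /andP[/andP[_ ->] ->].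
have iB j : j \in B -> [/\ j \in A, ~~ r i j, ~~ r j i & j != i].
  move=> /(subsetP BA); rewrite !inE => /andP[]; rewrite !negb_or => /and3P[-> a b] jA.
  by move: a b; rewrite jA.
exists (i |: B); split.
- by apply/subsetP => j /setU1P[->//|/iB[]].
- rewrite cardsU1 (_ : i \notin B); last by apply/negP => /iB[_ _ _]; rewrite eqxx.
  by rewrite cardAD mulnDr muln1 leq_add.
- move=> j l /setU1P[->|jB] /setU1P[->|lB] //; rewrite ?eqxx //.
  + by case: (iB l lB).
  + by case: (iB j jB).
  + exact: indB.
Qed.

(** * Colourings, connectedness and criticality *)

Section Colouring.
Variables (T : finType) (e : rel T).
Hypotheses (esym : symmetric e) (eirr : irreflexive e).
Implicit Types (X Y : {set T}) (k c : nat).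

(* Unlike [colorable_on], this allows k = 0 when A is empty and T is not. *)
Definition colb k (A : {set T}) : bool :=
  [exists f : {ffun T -> 'I_k.+1},
     [forall x in A, (f x < k) && [forall y in A, e x y ==> (f x != f y)]]].

Lemma colbP k (A : {set T}) :
  reflect (exists f : T -> nat, {in A, forall x, f x < k} /\
             {in A &, forall x y, e x y -> f x != f y})
          (colb k A).
Proof.
apply: (iffP existsP) => [[f /forall_inP fP]|[f [fk fP]]].
  exists (fun x => f x : nat); split=> [x /fP/andP[]//|x y /fP/andP[_ /forall_inP H] yA exy].
  by have := H y yA; rewrite exy.
exists [ffun x => inord (f x)]; apply/forall_inP => x xA; rewrite !ffunE.
have fx := fk x xA; rewrite inordK ?fx; last exact: ltnW.
apply/forall_inP => y yA; apply/implyP => exy; rewrite ffunE.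
rewrite -val_eqE /= !inordK ?ltnS; first exact: fP.
- by rewrite ltnW ?fk.
- exact: ltnW.
Qed.

Lemma colbS k X Y : X \subset Y -> colb k Y -> colb k X.
Proof.
move=> /subsetP XY /colbP[f [fk fP]]; apply/colbP; exists f.
by split=> [x /XY|x y /XY xY /XY yY]; [apply: fk | apply: fP].
Qed.

Lemma colb_leq k k' X : k <= k' -> colb k X -> colb k' X.
Proof.
move=> kk' /colbP[f [fk fP]]; apply/colbP; exists f; split=> // x xX.
exact: leq_trans (fk x xX) kk'.
Qed.

Lemma colb0 X : colb 0 X = (X == set0).
Proof.
apply/colbP/eqP => [[f [f0 _]]|->]; last by exists (fun=> 0); split=> x; rewrite inE.
by apply/setP => x; rewrite inE; apply/negP => /f0.
Qed.

Lemma colb_setU1 k x X : colb k X -> colb k.+1 (x |: X).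
Proof.
move=> /colbP[f [fk fP]]; apply/colbP.
have [xX|xX] := boolP (x \in X).
  rewrite (setUidPr _) ?sub1set //; exists f; split=> // y yX; exact: ltnW (fk y yX).
have lt y : y \in x |: X -> y != x -> f y < k.
  by case/setU1P => [->|yX]; [rewrite eqxx | rewrite fk].
exists (fun y => if y == x then k else f y); split=> [y yX|y z yX zX].
  by case: eqP => // /eqP yx; apply: ltnW; apply: lt.
case: (eqVneq y x) => [->|yx]; case: (eqVneq z x) => [->|zx]; rewrite ?eirr //.
- by have := lt z zX zx; lia.
- by have := lt y yX yx; lia.
- move: yX zX; rewrite !in_setU1 (negPf yx) (negPf zx) /=; exact: fP.
Qed.

(** The colour of [x] does not occur on [X], so it can replace colour [k] there. *)
Lemma colb_join k x X :
  {in X, forall y, e x y} -> colb k.+1 (x |: X) -> colb k X.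
Proof.
move=> xX /colbP[f [fk fP]]; apply/colbP.
have fx y : y \in X -> f x != f y.
  by move=> yX; apply: fP; rewrite ?setU11 ?setU1r ?xX.
exists (fun y => if f y == k then f x else f y); split=> [y yX|y z yX zX eyz].
  have := fk x (setU11 _ _); have := fk y (setU1r _ yX); have := fx y yX; case: (eqVneq (f y) k); lia.
have := fx y yX; have := fx z zX; have := fP y z (setU1r _ yX) (setU1r _ zX) eyz.
case: (eqVneq (f y) k); case: (eqVneq (f z) k); lia.
Qed.

(** Disjointness is built into anticompleteness. *)
Definition anti X Y := [forall x in X, forall y in Y, (x != y) && ~~ e x y].

Lemma antiP X Y : reflect {in X & Y, forall x y, x != y /\ ~~ e x y} (anti X Y).
Proof.
apply: (iffP forall_inP) => [H x y xX yY|H x xX].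
  by apply/andP; apply: (forall_inP (H x xX)).
by apply/forall_inP => y yY; apply/andP; apply: H.
Qed.

Lemma antiC X Y : anti X Y = anti Y X.
Proof.
by apply/antiP/antiP => H x y xX yY; rewrite eq_sym esym; apply: H.
Qed.

Lemma antiS X X' Y Y' : X' \subset X -> Y' \subset Y -> anti X Y -> anti X' Y'.
Proof.
move=> /subsetP XX /subsetP YY /antiP H; apply/antiP => x y /XX xX /YY yY.
exact: H.
Qed.

Lemma anti_setU1l x X Y : {in Y, forall y, x != y /\ ~~ e x y} -> anti X Y ->
  anti (x |: X) Y.
Proof. by move=> xY /antiP H; apply/antiP => a b /setU1P[->|]; [apply: xY | apply: H]. Qed.

(** Connectedness is stated through cuts, so that an edge between vertices with and without a given
    property is immediate ([connP]). The empty set counts as connected. *)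
Definition conn X :=
  [forall Y : {set T}, (Y \proper X) && (Y != set0) ==>
     [exists a in Y, exists b in X :\: Y, e a b]].

Lemma connP X (P : pred T) a b : conn X ->
  a \in X -> P a -> b \in X -> ~~ P b ->
  exists a' b', [/\ a' \in X, P a', b' \in X, ~~ P b' & e a' b'].
Proof.
move=> /forallP/(_ [set x in X | P x])/implyP H aX Pa bX Pb.
have [|a' a'X /exists_inP[b' b'X eab]] := exists_inP (H _).
  apply/andP; split; last by apply/set0Pn; exists a; rewrite inE aX.
  apply/properP; split; last by exists b; rewrite // inE (negPf Pb) andbF.
  by apply/subsetP => x; rewrite inE => /andP[].
move: a'X b'X; rewrite !inE => /andP[aX' Pa'] /andP[+ bX']; rewrite bX' /= => Pb'.
by exists a', b'.
Qed.

Lemma conn_setU1 x y X : conn X -> y \in X -> e x y -> conn (x |: X).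
Proof.
move=> cX yX exy; have [xX|xX] := boolP (x \in X); first by rewrite (setUidPr _) ?sub1set.
apply/forallP => Y; apply/implyP => /andP[/properP[/subsetP sY [b bX bY]]].
move=> /set0Pn[a aY].
have edge u v : u \in Y -> v \in x |: X -> v \notin Y -> e u v ->
    [exists a in Y, exists b in (x |: X) :\: Y, e a b].
  move=> uY vX vY euv; apply/exists_inP; exists u => //.
  by apply/exists_inP; exists v; rewrite // inE vY.
have [/exists_inP[u uX uY]|] := boolP [exists u in X, u \in Y]; last first.
  rewrite negb_exists_in => /forall_inP XY.
  have xY : x \in Y by have /setU1P[<-//|/XY] := sY a aY; rewrite aY.
  by apply: (edge x y) => //; rewrite ?XY ?setU1r.
have [/exists_inP[v vX vY]|] := boolP [exists v in X, v \notin Y].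
  have [a' [b' [? ? ? ? ?]]] := connP (P := fun z => z \in Y) cX uX uY vX vY.
  by apply: (edge a' b') => //; apply: setU1r.
rewrite negb_exists_in => /forall_inP XY.
apply: (edge y x); rewrite ?setU11 1?esym //; first by apply/negbNE/XY.
by case/setU1P: bX bY => [->//|/XY]; rewrite negbK => ->.
Qed.

(** An inclusion-minimal subset works: deleting one vertex leaves a [c]-colourable set, and a cut
    without edges would allow the colourings of its two sides to be glued. *)
Lemma minimal_uncolourable c X : ~~ colb c X ->
  exists Y, [/\ Y \subset X, conn Y, colb c.+1 Y & ~~ colb c Y].
Proof.
move=> nX; have [Y /minsetP[nY minY] YX] := minset_exists (P := fun Y => ~~ colb c Y) nX.
exists Y; split=> //; last first.
  have [y yY] : exists y, y \in Y.
    by apply/set0Pn; apply: contraNneq nY => ->; apply/colbP; exists (fun=> 0);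
       split=> x; rewrite inE.
  rewrite -(setD1K yY); apply: colb_setU1; apply: contraT => nY'.
  by have := minY _ nY' (subsetDl _ _) => /setP/(_ y); rewrite !inE eqxx yY.
have propcol (Z : {set T}) : Z \proper Y -> colb c Z.
  move=> ZY; apply: contraT => nZ.
  by have := minY Z nZ (proper_sub ZY) => E; rewrite E properxx in ZY.
apply/forallP => Z; apply/implyP => /andP[ZY /set0Pn[z zZ]].
have [//|noedge] := boolP [exists a in Z, exists b in Y :\: Z, e a b].
case/negP: nY; have /colbP[f [fk fP]] := propcol Z ZY.
have /propcol/colbP[g [gk gP]] : Y :\: Z \proper Y.
  apply/properP; split; first exact: subsetDl.
  by exists z; rewrite ?inE ?zZ // (subsetP (proper_sub ZY)).
have noe a b : a \in Z -> b \in Y -> b \notin Z -> ~~ e a b.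
  move=> aZ bY bZ; apply: contra noedge => eab.
  by apply/exists_inP; exists a => //; apply/exists_inP; exists b; rewrite // inE bZ.
apply/colbP; exists (fun x => if x \in Z then f x else g x); split=> [x xY|x y xY yY exy].
  by case: ifPn => xZ; [apply: fk | apply: gk; rewrite inE xZ].
case: ifPn => xZ; case: ifPn => yZ.
- exact: fP.
- by have := noe x y xZ yY yZ; rewrite exy.
- by have := noe y x yZ xY xZ; rewrite esym exy.
- by apply: gP => //; rewrite inE ?xZ ?yZ.
Qed.

Lemma clique_leq k (I : finType) (A : {set I}) (w : I -> T) :
  colb k [set: T] -> {in A &, forall i j, i != j -> e (w i) (w j)} -> #|A| <= k.
Proof.
move=> /colbP[f [fk fP]] cl.
have fkA : {in A, forall i, f (w i) < k.+1}.
  by move=> i _; rewrite ltnS ltnW ?fk ?inE.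
case: k fk fkA => [|k] fk fkA.
  by rewrite leqn0 cards_eq0; apply/eqP/setP=> i; rewrite inE; have := fk (w i) (in_setT _).
rewrite -[k.+1]card_ord -(card_in_imset (f := fun i => inord (f (w i)) : 'I_k.+1)).
  exact: max_card.
move=> i j iA jA /(congr1 (@nat_of_ord _)) /=; rewrite !inordK ?fk // => E.
apply: contraTeq isT => ij.
by have := fP (w i) (w j) (in_setT _) (in_setT _) (cl i j iA jA ij); rewrite E eqxx.
Qed.

(** The largest colour class, by the pigeonhole principle. *)
Lemma independent_selection k (I : finType) (A : {set I}) (w : I -> T) :
  colb k [set: T] ->
  exists B : {set I}, [/\ B \subset A, #|A| <= k * #|B|
    & {in B &, forall i j, ~~ e (w i) (w j)}].
Proof.
move=> /colbP[f [fk fP]].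
pose cl (a : 'I_k) := [set i in A | f (w i) == a].
have sumA : #|A| = \sum_(a < k) #|cl a|.
  rewrite -sum1_card (partition_big (fun i => Ordinal (fk (w i) (in_setT _))) xpredT) //=.
  by apply: eq_bigr => a _; rewrite -sum1dep_card.
case: (posnP k) => [k0|k0].
  exists set0; rewrite sub0set cards0 muln0 sumA big1 => [|a _]; last by have := ltn_ord a; rewrite [X in _ < X]k0.
  by split=> // i j; rewrite inE.
pose a := [arg max_(a > Ordinal k0) #|cl a|].
have maxa b : #|cl b| <= #|cl a| by rewrite /a; case: arg_maxnP => //= i _ H; apply: H.
exists (cl a); split.
- by apply/subsetP => i; rewrite inE => /andP[].
- have: \sum_(b < k) #|cl b| <= \sum_(b < k) #|cl a| by apply: leq_sum => b _; apply: maxa.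
  by rewrite sumA sum_nat_const card_ord.
- move=> i j; rewrite !inE => /andP[_ /eqP fi] /andP[_ /eqP fj].
  apply/negP => eij; have := fP (w i) (w j) (in_setT _) (in_setT _) eij.
  by rewrite fi fj eqxx.
Qed.

(* If the colours seen by X were avoided by a colour set of size > c on Y,
   then X could be recoloured with colours of Y. *)
Lemma critical_private_neighbour k c X Y :
  ~~ colb k [set: T] -> (forall v, colb k [set~ v]) -> anti X Y ->
  colb c.+1 X -> ~~ colb c X -> ~~ colb c Y ->
  exists w x y, [/\ w \notin X, x \in X, y \in Y, e w x & ~~ e w y].
Proof.
move=> nT cT XY /colbP[g [gc gP]] nX nY.
have [v vX] : exists v, v \in X.
  by apply/set0Pn; apply: contraNneq nX => ->; apply/colbP; exists (fun=> 0);
     split=> x; rewrite inE.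
have [/exists_inP[w wX /exists_inP[x xX /andP[ewx]]]|nw] :=
  boolP [exists w in ~: X, exists x in X, e w x && [exists y in Y, ~~ e w y]].
  by move=> /exists_inP[y yY ewy]; exists w, x, y; rewrite inE in wX.
case/negP: nT; have /colbP[f [fk fP]] := cT v.
have complete w x y : w \notin X -> x \in X -> y \in Y -> e w x -> e w y.
  move=> wX xX yY ewx; apply: contraR nw => ewy; apply/exists_inP; exists w; rewrite ?inE //.
  by apply/exists_inP; exists x; rewrite // ewx; apply/exists_inP; exists y.
(* [L] is the palette of [f] on [Y], and it has more than [c] colours. Every outside neighbour of
   [X] is complete to [Y] and hence avoids [L], so [X], including [v], can be coloured by [g] with
   its values read as positions in [L]. *)
pose L := undup [seq f y | y <- enum Y].
have LY y : y \in Y -> f y \in L.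
  by move=> yY; rewrite mem_undup map_f ?mem_enum.
have YL a : a \in L -> exists2 y, y \in Y & a = f y.
  by rewrite mem_undup => /mapP[y]; rewrite mem_enum; exists y.
have Yv y : y \in Y -> y \in [set~ v].
  by move=> yY; rewrite !inE eq_sym; case: (antiP _ _ XY v y vX yY).
have sL : c < size L.
  rewrite ltnNge; apply: contra nY => sL; apply/colbP; exists (fun y => index (f y) L).
  split=> [y yY|y z yY zY eyz]; first by apply: leq_trans sL; rewrite index_mem LY.
  have := fP y z (Yv y yY) (Yv z zY) eyz; apply: contra => /eqP E; apply/eqP.
  by rewrite -(nth_index 0 (LY y yY)) E nth_index ?LY.
have gL x : x \in X -> g x < size L by move=> xX; apply: leq_trans sL; rewrite gc.
have mix x z : x \in X -> z \notin X -> e z x -> f z != nth 0 L (g x).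
  move=> xX zX ezx; have [y yY ->] := YL _ (mem_nth 0 (gL x xX)).
  apply: fP; [|exact: Yv|exact: complete yY ezx].
  by rewrite !inE; apply: contraNneq zX => ->.
apply/colbP; exists (fun x => if x \in X then nth 0 L (g x) else f x); split.
  move=> x _; case: ifPn => xX; last by apply: fk; rewrite !inE; apply: contraNneq xX => ->.
  by have [y yY ->] := YL _ (mem_nth 0 (gL x xX)); apply/fk/Yv.
move=> x y _ _ exy; case: ifPn => xX; case: ifPn => yX.
- by rewrite nth_uniq ?gL ?undup_uniq //; apply: gP.
- by rewrite eq_sym; apply: mix; rewrite // esym.
- exact: mix.
- by apply: fP; rewrite // !inE; [apply: contraNneq xX | apply: contraNneq yX] => ->.
Qed.

End Colouring.

(** * Stable sets with incomparable neighbourhoods *)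

Section Free.
Variables (T : finType) (e : rel T).
Hypotheses (esym : symmetric e) (eirr : irreflexive e).
Hypotheses (P5free : H_free (path_rel 5) e) (chairfree : H_free chair_rel e).

Lemma neq_adj x y z : e x z != e y z -> x != y.
Proof. by apply: contraNneq => ->. Qed.

Lemma P5_absurd a b c d f :
  e a b -> e b c -> e c d -> e d f ->
  ~~ e a c -> ~~ e a d -> ~~ e a f -> ~~ e b d -> ~~ e b f -> ~~ e c f -> False.
Proof.
move=> ab bc cd df /negPf ac /negPf ad /negPf af /negPf bd /negPf bf /negPf cf.
pose E := (ab, bc, cd, df, ac, ad, af, bd, bf, cf, eirr).
pose E' := (E, esym b a, esym c b, esym d c, esym f d, esym c a, esym d a, esym f a,
  esym d b, esym f b, esym f c).
apply: P5free; exists (fun i => nth a [:: a; b; c; d; f] i).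
split=> [i j /eqP|].
  rewrite nth_uniq // => [/eqP/val_inj//|]; rewrite /= !inE !negb_or !andbT.
  rewrite (@neq_adj a b b) ?(@neq_adj a c d) ?(@neq_adj a d b) ?(@neq_adj a f b) ?E' //.
  rewrite (@neq_adj b c c) ?(@neq_adj b d a) ?(@neq_adj b f a) ?E' //.
  by rewrite (@neq_adj c d b) ?(@neq_adj c f b) ?(@neq_adj d f c) ?E'.
move=> [i Hi] [j Hj]; move: i Hi j Hj.
by case=> [|[|[|[|[|i]]]]] Hi; case=> [|[|[|[|[|j]]]]] Hj //=; rewrite ?E'.
Qed.

(** The leaves [a] and [f] are twins in the chair, so no adjacency separates them and their
    distinctness is assumed; all other pairs are told apart by a third vertex. *)
Lemma chair_absurd a b c d f :
  e a b -> e b c -> e c d -> e b f -> a != f ->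
  ~~ e a c -> ~~ e a d -> ~~ e a f -> ~~ e b d -> ~~ e c f -> ~~ e d f -> False.
Proof.
move=> ab bc cd bf naf /negPf ac /negPf ad /negPf af /negPf bd /negPf cf /negPf df.
pose E := (ab, bc, cd, df, ac, ad, af, bd, bf, cf, eirr).
pose E' := (E, esym b a, esym c b, esym d c, esym f d, esym c a, esym d a, esym f a,
  esym d b, esym f b, esym f c).
apply: chairfree; exists (fun i => nth a [:: a; b; c; d; f] i).
split=> [i j /eqP|].
  rewrite nth_uniq // => [/eqP/val_inj//|]; rewrite /= !inE !negb_or !andbT naf.
  rewrite (@neq_adj a b b) ?(@neq_adj a c d) ?(@neq_adj a d b) ?E' //.
  rewrite (@neq_adj b c a) ?(@neq_adj b d a) ?(@neq_adj b f a) ?E' //.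
  by rewrite (@neq_adj c d b) ?(@neq_adj c f d) ?(@neq_adj d f b) ?E'.
move=> [i Hi] [j Hj]; move: i Hi j Hj.
by case=> [|[|[|[|[|i]]]]] Hi; case=> [|[|[|[|[|j]]]]] Hj //=; rewrite ?E'.
Qed.

(* For each i pick a vertex w i in W seeing s i and as few of the s j as possible.
   A competitor seeing s i but not one of these s j is adjacent to w i and
   trades s j for a single other s l; competitors for distinct j are adjacent,
   so w i and its competitors form a clique and w i sees at most k of the s j. *)
Lemma antichain_matching k (I : finType) (A : {set I}) (s : I -> T) (W : {set T}) :
  colb e k [set: T] -> 1 < #|A| ->
  {in A &, forall i j, i != j -> s i != s j} ->
  {in A &, forall i j, ~~ e (s i) (s j)} ->
  {in A &, forall i j, i != j -> exists w, [/\ w \in W, e w (s i) & ~~ e w (s j)]} ->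
  exists (B : {set I}) (w : I -> T), [/\ B \subset A,
    #|A| <= (2 * k).+1 * k * #|B|,
    {in B, forall i, w i \in W},
    {in B &, forall i j, e (w i) (s j) = (i == j)} &
    {in B &, forall i j, ~~ e (w i) (w j)}].
Proof.
move=> col A2 sneq sind sep.
pose tr w := [set j in A | e w (s j)].
have trP w j : j \in tr w -> j \in A /\ e w (s j) by rewrite inE => /andP.
(* Nonadjacent vertices whose traces meet have nested traces: otherwise [s j], [x], [s i], [y],
   [s l] induce a [P5]. *)
have nested x y i j l : ~~ e x y -> i \in tr x -> i \in tr y ->
    j \in tr x -> j \notin tr y -> l \in tr y -> l \notin tr x -> False.
  move=> xy /trP[iA xi] /trP[_ yi] /trP[jA xj] jy /trP[lA yl] lx.
  move: jy lx; rewrite !inE jA lA /= => yj xl.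
  apply: (@P5_absurd (s j) x (s i) y (s l));
    by [exact: sind | rewrite // esym].
(* Otherwise [y] is the centre of a chair with leaves [s j] and [s l] and long arm [x], [s i]. *)
have diff1 x y i j l : e x y -> i \in tr x -> i \notin tr y ->
    j \in tr y -> l \in tr y -> j \notin tr x -> l \notin tr x -> j = l.
  move=> exy /trP[iA xi] + /trP[jA yj] /trP[lA yl].
  rewrite !inE iA jA lA /= => yi xj xl; apply/eqP; apply: contraT => jl.
  case: (@chair_absurd (s j) y x (s i) (s l));
    by [exact: sind | exact: sneq | rewrite // esym].
have /fin_all_exists[w wP] : forall i, exists w, i \in A ->
    [/\ w \in W, i \in tr w & forall w', w' \in W -> i \in tr w' -> #|tr w| <= #|tr w'|].
  move=> i; have [iA|_] := boolP (i \in A); last by exists (s i).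
  have [j jA ji] : exists2 j, j \in A & j != i.
    have : A :\ i != set0 by rewrite -card_gt0; move: A2; rewrite (cardsD1 i A) iA.
    by case/set0Pn => j /setD1P[]; exists j.
  have [|w0 [w0W w0i _]] := sep i j iA jA; first by rewrite eq_sym.
  have w0P : (w0 \in W) && (i \in tr w0) by rewrite w0W inE iA.
  exists [arg min_(w < w0 | (w \in W) && (i \in tr w)) #|tr w|] => _.
  case: arg_minnP => // w /andP[wW wi] minw; split=> // w' w'W w'i.
  by apply: minw; rewrite w'W.
have trk i : i \in A -> #|tr (w i)| <= k.
  move=> iA; have [wW iw minw] := wP i iA.
  have /fin_all_exists[u uP] : forall j, exists u, j \in A -> j != i ->
      [/\ u \in W, i \in tr u & j \notin tr u].
    move=> j; have [/andP[jA ji]|nj] := boolP ((j \in A) && (j != i)).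
      have [|v [vW vi vj]] := sep i j iA jA; first by rewrite eq_sym.
      by exists v; rewrite !inE iA jA.
    by exists (s i) => jA ji; rewrite jA ji in nj.
  have trade j : j \in tr (w i) -> j != i ->
      e (u j) (w i) /\ forall l, l \in tr (w i) -> l != j -> l \in tr (u j).
    move=> jw ji; have [jA _] := trP _ _ jw; have [uW iu ju] := uP j jA ji.
    have [l lu lw] : exists2 l, l \in tr (u j) & l \notin tr (w i).
      apply/subsetPn; apply: contraL (minw _ uW iu) => sub; rewrite -ltnNge.
      by apply: proper_card; apply/properP; split=> //; exists j.
    have euw : e (u j) (w i).
      by apply: contraT => n; case: (nested _ _ _ _ _ n iu iw lu lw jw ju).
    split=> // m mw mj; apply: contraT => mu.
    by rewrite (diff1 _ _ _ _ _ euw lu lw mw jw mu ju) eqxx in mj.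
  apply: (clique_leq (w := fun j => if j == i then w i else u j) col) => j l jw lw jl.
  case: (eqVneq j i) jw jl => [->|ji] jw; case: (eqVneq l i) lw => [->|li] lw jl.
  - by move: jl.
  - by rewrite esym; case: (trade l lw li).
  - by case: (trade j jw ji).
  - have [jA _] := trP _ _ jw; have [lA _] := trP _ _ lw.
    have [_ iuj juj] := uP j jA ji; have [_ iul lul] := uP l lA li.
    have [_ /(_ l lw)] := trade j jw ji; rewrite eq_sym => /(_ jl) luj.
    have [_ /(_ j jw jl) jul] := trade l lw li.
    by apply: contraT => n; case: (nested _ _ _ _ _ n iuj iul luj lul jul juj).
(* Since [w i] sees at most [k] of the [s j], a sparse selection leaves only the matching edges; a
   colour class of the [w i] then makes them pairwise nonadjacent. *)
have [i iA|B1 [B1A cardB1 B1P]] :=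
  @sparse_selection _ (fun i j => (j != i) && e (w i) (s j)) k A.
  apply: leq_trans (trk i iA); apply/subset_leq_card/subsetP => j.
  by rewrite !inE => /and3P[-> _ ->].
have [B [BB1 cardB BP]] := independent_selection B1 w col.
exists B, w; split=> //; first exact: subset_trans BB1 B1A.
  by rewrite -mulnA; apply: leq_trans cardB1 _; rewrite leq_mul2l cardB orbT.
  by move=> i /(subsetP BB1)/(subsetP B1A)/wP[].
move=> i j /(subsetP BB1) iB /(subsetP BB1) jB.
have [<-|ij] := eqVneq i j.
  by have [_ + _] := wP i (subsetP B1A _ iB); rewrite inE => /andP[].
by apply/negbTE; have := B1P i j iB jB ij; rewrite eq_sym ij.
Qed.

End Free.

(** * Anticomplete sets of large chromatic number *)

Section Packing.
Variables (T : finType) (e : rel T).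
Hypotheses (esym : symmetric e) (eirr : irreflexive e).
Hypotheses (P5free : H_free (path_rel 5) e) (chairfree : H_free chair_rel e).

(** The quantity carried through the induction on [c]. Members are indexed, so that a selection only
    shrinks the index set. *)
Definition packing m c := exists (I : finType) (A : {set I}) (X : I -> {set T}),
  [/\ m <= #|A|, {in A &, forall i j, i != j -> anti e (X i) (X j)}
    & {in A, forall i, ~~ colb e c (X i)}].

(** * Vertices mixed on a connected set *)

Definition sees x (X : {set T}) := [exists a in X, e x a].
Definition mixed x (X : {set T}) := sees x X && [exists b in X, ~~ e x b].

Lemma sees_notin x (X Y : {set T}) : anti e X Y -> sees x X -> x \notin Y.
Proof.
move=> /antiP XY /exists_inP[a aX exa]; apply/negP => xY.
by have [_] := XY a x aX xY; rewrite esym exa.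
Qed.

Lemma seesPn x (X : {set T}) : reflect {in X, forall y, ~~ e x y} (~~ sees x X).
Proof. by rewrite /sees negb_exists_in; apply: forall_inP. Qed.

Lemma mixed_edge x (X : {set T}) : conn e X -> mixed x X ->
  exists a b, [/\ a \in X, e x a, b \in X, ~~ e x b & e a b].
Proof.
move=> cX /andP[/exists_inP[a aX xa] /exists_inP[b bX xb]].
exact: (connP (P := e x) cX aX xa bX xb).
Qed.

(** A vertex mixed on both sets would yield an induced [P5] with [x] in the middle and an edge of
    each set on either side. *)
Lemma mixed_complete x (X Y : {set T}) : conn e X -> conn e Y -> anti e X Y ->
  mixed x X -> sees x Y -> {in Y, forall y, e x y}.
Proof.
move=> cX cY /antiP XY mX sY y yY; apply: contraT => xy.
have [a [b [aX xa bX xb ab]]] := mixed_edge cX mX.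
have [a' [b' [aY xa' bY xb' ab']]] : exists a b, [/\ a \in Y, e x a, b \in Y, ~~ e x b & e a b].
  by apply: mixed_edge => //; rewrite /mixed sY; apply/exists_inP; exists y.
case: (@P5_absurd _ e esym eirr P5free b a x a' b');
  by [case: (XY a a') | case: (XY a b') | case: (XY b a') | case: (XY b b') | rewrite // esym].
Qed.

(** Otherwise [x] is the centre of a chair with leaves [y] and [z] and long arm [a], [b] in [X]. *)
Lemma mixed_sees_once x (X Y Z : {set T}) : conn e X ->
  anti e X Y -> anti e X Z -> anti e Y Z ->
  mixed x X -> sees x Y -> sees x Z -> False.
Proof.
move=> cX /antiP XY /antiP XZ /antiP YZ mX /exists_inP[y yY xy] /exists_inP[z zZ xz].
have [a [b [aX xa bX xb ab]]] := mixed_edge cX mX.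
case: (@chair_absurd _ e esym eirr chairfree y x a b z);
  by [case: (XZ a z) | case: (XZ b z) | case: (YZ y z)
     | rewrite esym; case: (XY a y) | rewrite esym; case: (XY b y) | rewrite // esym].
Qed.

(** An edge between [x] and [y] would create the induced [P5] on [b], [a], [x], [y], [d]. *)
Lemma mixed_nonadjacent x y (X Y : {set T}) : conn e X -> anti e X Y ->
  mixed x X -> sees y Y -> ~~ sees x Y -> ~~ sees y X -> ~~ e x y.
Proof.
move=> cX /antiP XY mX /exists_inP[d dY yd] /seesPn xY /seesPn yX.
have [a [b [aX xa bX xb ab]]] := mixed_edge cX mX; apply/negP => exy.
case: (@P5_absurd _ e esym eirr P5free b a x y d);
  by [apply: xY | case: (XY a d) | case: (XY b d)
     | rewrite esym; apply: yX | rewrite // esym].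
Qed.

(** The vertices [b], [a], [x], [z], [y] would induce a [P5]. This prevents two new vertices from
    being attached to the same member. *)
Lemma mixed_attach_distinct x y z (X Z : {set T}) : conn e X -> anti e X Z ->
  mixed x X -> ~~ sees y X -> ~~ e x y ->
  z \in Z -> e x z -> e y z -> False.
Proof.
move=> cX /antiP XZ mX /seesPn yX xy zZ xz yz.
have [a [b [aX xa bX xb ab]]] := mixed_edge cX mX.
case: (@P5_absurd _ e esym eirr P5free b a x z y);
  by [case: (XZ a z) | case: (XZ b z) | rewrite esym; apply: yX | rewrite // esym].
Qed.

(** * Enlarging the members of a maximal family *)

Section Family.
Variables (c : nat) (I : finType) (A : {set I}) (X : I -> {set T}) (x0 : T).
Hypothesis Xanti : {in A &, forall i j, i != j -> anti e (X i) (X j)}.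
Hypothesis Xconn : {in A, forall i, conn e (X i)}.
Hypothesis Xcol : {in A, forall i, ~~ colb e c (X i)}.

(* An extended set x |: X i that still avoids all the other X j needs more
   colours; this is what maximality of the family provides. *)
Hypothesis Xmax : forall i x, i \in A -> x \notin X i -> sees x (X i) ->
  {in A, forall j, j != i -> ~~ sees x (X j)} -> ~~ colb e c.+1 (x |: X i).

Definition inhomogeneous i := [exists x, (x \notin X i) && mixed x (X i)].

(* x i is mixed on X i, and X (j i) is the member of the family (possibly X i
   itself) whose chromatic number increases when x i is added. *)
Lemma inhomogeneous_attach : exists (x : I -> T) (j : I -> I),
  forall i, i \in A -> inhomogeneous i ->
  [/\ mixed (x i) (X i), j i \in A, ~~ colb e c.+1 (x i |: X (j i)),
      sees (x i) (X (j i))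
    & {in A, forall l, l != i -> l != j i -> ~~ sees (x i) (X l)}].
Proof.
suff /fin_all_exists[p pP] : forall i, exists p : T * I, i \in A -> inhomogeneous i ->
    [/\ mixed p.1 (X i), p.2 \in A, ~~ colb e c.+1 (p.1 |: X p.2), sees p.1 (X p.2)
      & {in A, forall l, l != i -> l != p.2 -> ~~ sees p.1 (X l)}].
  by exists (fun i => (p i).1), (fun i => (p i).2).
move=> i; have [iA|_] := boolP (i \in A); last by exists (x0, i).
have [|_] := boolP (inhomogeneous i); last by exists (x0, i).
case/existsP => x /andP[xi mx].
(* If [x] sees another member, it is complete to it and sees no third one, so joining it there costs
   a colour. If [x] sees only [X i], maximality gives the extra colour. *)
have [/exists_inP[j jA /andP[ji xj]]|alone] :=
  boolP [exists j in A, (j != i) && sees x (X j)].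
  have Xij : anti e (X i) (X j) by apply: Xanti; rewrite // eq_sym.
  exists (x, j) => _ _; split=> //=.
    by apply: contra (Xcol jA); apply/colb_join/mixed_complete/xj/mx => //; apply: Xconn.
  move=> l lA li lj; apply/negP => xl.
  by case: (@mixed_sees_once x (X i) (X j) (X l)); rewrite ?Xconn ?Xanti // eq_sym.
exists (x, i) => _ _; have si : sees x (X i) by case/andP: mx.
have away : {in A, forall l, l != i -> ~~ sees x (X l)}.
  move=> l lA li; apply: contra alone => xl; apply/exists_inP; exists l => //.
  by rewrite li.
by split=> //=; [apply: Xmax | move=> l lA li _; apply: away].
Qed.

Lemma inhomogeneous_packing m (A' : {set I}) : A' \subset A ->
  {in A', forall i, inhomogeneous i} -> 3 * m <= #|A'| -> packing m c.+1.
Proof.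
move=> /subsetP A'A inh cardA'; have [x [j xj]] := inhomogeneous_attach.
(* Each [i] conflicts only with [j i], whence the factor [3 = 2 * 1 + 1]. After the selection, [x i]
   sees no [X l] with [l] in [B] other than [i]. *)
have [i _|B [/subsetP BA' cardB sel]] :=
  @sparse_selection _ (fun i l => l == j i) 1 A'.
  by apply: leq_trans (subset_leq_card _) (eq_leq (cards1 (j i)));
     apply/subsetP => l; rewrite !inE => /andP[].
exists I, B, (fun i => x i |: X (j i)).
have BA i : i \in B -> i \in A by move=> /BA'/A'A.
have xP i : i \in B -> [/\ mixed (x i) (X i), j i \in A,
    ~~ colb e c.+1 (x i |: X (j i)), sees (x i) (X (j i))
  & {in A, forall l, l != i -> l != j i -> ~~ sees (x i) (X l)}].
  by move=> iB; apply: xj; rewrite ?BA ?inh ?BA'.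
split; [by rewrite -(leq_pmul2l (isT : 0 < 3)); apply: leq_trans cardB| |by move=> i /xP[]].
have nsee i l : i \in B -> l \in B -> i != l -> ~~ sees (x i) (X l).
  move=> iB lB il; have [_ _ _ _ ns] := xP i iB; have lA := BA l lB.
  by apply: ns; rewrite // ?sel // eq_sym.
have nadj i l : i \in B -> l \in B -> i != l -> ~~ e (x i) (x l).
  move=> iB lB il; have iA := BA i iB; have lA := BA l lB; have [mi _ _ _ _] := xP i iB; have [ml _ _ _ _] := xP l lB.
  apply: (@mixed_nonadjacent _ _ (X i) (X l)); rewrite ?Xconn ?Xanti ?nsee //.
    by case/andP: ml.
  by rewrite eq_sym.
(* If [j i = j l], both [x i] and [x l] are complete to that member, and a vertex [z] of it is a
   forbidden common neighbour. *)
have njj i l : i \in B -> l \in B -> i != l -> j i != j l.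
  move=> iB lB il; apply/eqP => jil.
  have iA := BA i iB; have lA := BA l lB; have [mi jA _ si _] := xP i iB; have [ml _ _ sl _] := xP l lB.
  have li : l != i by rewrite eq_sym.
  have ji : i != j i by rewrite jil sel.
  have jl : l != j l by rewrite -jil sel.
  have [z zj _] := exists_inP si.
  apply: (@mixed_attach_distinct (x i) (x l) z (X i) (X (j i)));
    rewrite ?Xconn ?Xanti ?nsee ?nadj //.
    by apply: (mixed_complete (X := X i) (Y := X (j i))); rewrite ?Xconn ?Xanti.
  by rewrite jil in zj jA *; apply: (mixed_complete (X := X l) (Y := X (j l)));
    rewrite ?Xconn ?Xanti.
(* The index [j l] may lie outside [B], so the argument uses that it differs from both [i] and
   [j i]. *)
have off i l : i \in B -> l \in B -> i != l ->
    {in X (j l), forall y, x i != y /\ ~~ e (x i) y}.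
  move=> iB lB il y yX; have iA := BA i iB; have [mi jiA _ si ns] := xP i iB; have [_ jlA _ _ _] := xP l lB.
  have jli : j l != i by rewrite eq_sym sel // eq_sym.
  have jlji : j l != j i by rewrite eq_sym njj.
  split; last by apply: (seesPn _ _ (ns _ jlA jli jlji)).
  apply: contraTneq yX => <-; apply: (@sees_notin _ (X (j i))) => //.
  by apply: Xanti; rewrite // eq_sym.
move=> i l iB lB il; have li : l != i by rewrite eq_sym.
have [mi jiA _ _ _] := xP i iB; have [_ jlA _ _ _] := xP l lB.
apply: anti_setU1l => [y /setU1P[->|]|]; last 1 first.
- rewrite antiC //; apply: anti_setU1l; first exact: off.
  by apply: Xanti; rewrite ?njj.
- split; last exact: nadj.
  by apply: contraNneq (nsee l i lB iB li) => <-; case/andP: mi.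
- exact: off.
Qed.

(* By criticality, homogeneous members have incomparable neighbourhoods, and a
   private neighbour of X i raises its chromatic number. *)
Lemma homogeneous_packing k m (A' : {set I}) : A' \subset A ->
  ~~ colb e k [set: T] -> (forall v, colb e k [set~ v]) ->
  {in A, forall i, colb e c.+1 (X i)} ->
  {in A', forall i, ~~ inhomogeneous i} -> 1 < #|A'| ->
  (2 * k.+1).+1 * k.+1 * m <= #|A'| -> packing m c.+1.
Proof.
move=> /subsetP A'A nT cT Xcol1 hom A'1 cardA'.
have colT : colb e k.+1 [set: T].
  by rewrite -(setUCr [set x0]); apply: colb_setU1.
have homP i x a : i \in A' -> x \notin X i -> a \in X i -> e x a ->
    {in X i, forall y, e x y}.
  move=> iA' xi aX xa y yX; apply: contraT => xy.
  case/existsP: (hom i iA'); exists x; rewrite xi /=; apply/andP; split.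
    by apply/exists_inP; exists a.
  by apply/exists_inP; exists y.
have /fin_all_exists[s sP] : forall i, exists x, i \in A -> x \in X i.
  move=> i; have [iA|_] := boolP (i \in A); last by exists x0.
  have /set0Pn[x xX] : X i != set0.
    by rewrite -(colb0 e); apply: contra (Xcol iA); apply: colb_leq.
  by exists x.
(* Homogeneity concerns vertices outside a member. A private neighbour of one member lies in no
   member, by anticompleteness, so it is in [W]; it then sees all or none of each [X i] with [i] in
   [A'], and the representative [s i] decides which. *)
pose W := [set w | [forall i in A, w \notin X i]].
have WP w i : w \in W -> i \in A -> w \notin X i by rewrite inE => /forall_inP; apply.
have XantiP i l x y : i \in A' -> l \in A' -> i != l -> x \in X i -> y \in X l ->
    x != y /\ ~~ e x y.
  by move=> /A'A iA /A'A lA il; apply/antiP/Xanti.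
have s' i : i \in A' -> s i \in X i by move=> /A'A; apply: sP.
have [|i l iA lA il|i l iA lA|i l iA lA il|B [w [/subsetP BA' cardB wW ws wind]]] :=
  @antichain_matching _ e esym eirr P5free chairfree k.+1 I A' s W colT.
- by [].
- by case: (XantiP i l (s i) (s l)) => //; apply: s'.
- have [->|il] := eqVneq i l; first by rewrite eirr.
  by case: (XantiP i l (s i) (s l)) => //; apply: s'.
- have [iA0 lA0] := (A'A i iA, A'A l lA).
  have [w [x [y [wi xi yl wx wy]]]] :=
    critical_private_neighbour esym nT cT (Xanti iA0 lA0 il) (Xcol1 i iA0) (Xcol iA0) (Xcol lA0).
  have wsee : sees w (X i) by apply/exists_inP; exists x.
  have wW : w \in W.
    rewrite inE; apply/forall_inP => q qA; have [->//|qi] := eqVneq q i.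
    by apply: sees_notin wsee; apply: Xanti; rewrite // eq_sym.
  exists w; split=> //; first by apply: (homP i w x) => //; apply: s'.
  by apply: contra wy => wl; apply: (homP l w (s l)); rewrite ?s' // WP.
exists I, B, (fun i => w i |: X i).
have wX i : i \in B -> {in X i, forall y, e (w i) y}.
  move=> iB; have iA := BA' i iB; apply: (homP i (w i) (s i)); rewrite ?s' ?ws //.
  by apply: WP; rewrite ?wW ?A'A.
have off i l : i \in B -> l \in B -> i != l -> {in X l, forall y, w i != y /\ ~~ e (w i) y}.
  move=> iB lB il y yX; have lA := BA' l lB.
  have wl : w i \notin X l by apply: WP; rewrite ?wW ?A'A.
  split; first by apply: contraNneq wl => ->.
  apply: contraTN isT => wy; have := homP l (w i) y lA wl yX wy (s l) (s' l lA).
  by rewrite ws // (negPf il).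
split.
- have: (2 * k.+1).+1 * k.+1 * m <= (2 * k.+1).+1 * k.+1 * #|B| by apply: leq_trans cardB.
  by rewrite leq_pmul2l // muln_gt0.
- move=> i l iB lB il; have li : l != i by rewrite eq_sym.
  apply: anti_setU1l => [y /setU1P[->|]|]; last 1 first.
  + rewrite antiC //; apply: anti_setU1l; first exact: off.
    by apply: Xanti; rewrite // A'A // BA'.
  + split; last exact: wind.
    by apply/eqP => wil; have := ws l i lB iB; rewrite -wil ws // eqxx (negPf li).
  + exact: off.
- move=> i iB; apply: contra (Xcol (A'A i (BA' i iB))).
  by apply: colb_join; apply: wX.
Qed.

End Family.

(** * The induction step and the bound on the order *)

Definition packing_factor k := 3 + (2 * k.+1).+1 * k.+1.

Lemma packing_step k c m :
  ~~ colb e k [set: T] -> (forall v, colb e k [set~ v]) -> 0 < m ->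
  packing (packing_factor k * m) c -> packing m c.+1.
Proof.
move=> nT cT m0 [I [A [Y [cardA Yanti Ycol]]]].
have [x0 _] : exists x0, x0 \in [set: T].
  by apply/set0Pn; rewrite -(colb0 e); apply: contra nT; apply: colb_leq.
pose valid (X : {ffun I -> {set T}}) :=
  [forall i in A, [&& conn e (X i), colb e c.+1 (X i), ~~ colb e c (X i)
     & [forall j in A, (i != j) ==> anti e (X i) (X j)]]].
have validP (X : {ffun I -> {set T}}) : reflect [/\ {in A, forall i, conn e (X i)}, {in A, forall i, colb e c.+1 (X i)},
    {in A, forall i, ~~ colb e c (X i)} & {in A &, forall i j, i != j -> anti e (X i) (X j)}]
    (valid X).
  apply: (iffP forall_inP) => [H|[H1 H2 H3 H4] i iA].
    split=> i; try by move=> /H/and4P[].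
    by move=> j /H/and4P[_ _ _ /forall_inP H4] jA ij; have := H4 j jA; rewrite ij.
  rewrite H1 ?H2 ?H3 //=; apply/forall_inP => j jA; apply/implyP; exact: H4.
have /fin_all_exists[Z ZP] : forall i, exists Z : {set T}, i \in A ->
    [/\ Z \subset Y i, conn e Z, colb e c.+1 Z & ~~ colb e c Z].
  move=> i; have [iA|_] := boolP (i \in A); last by exists set0.
  by have [Z ?] := minimal_uncolourable esym eirr (Ycol i iA); exists Z.
have Z0 : valid (finfun Z).
  apply/validP; split=> i; rewrite ?ffunE; try by move=> /ZP[].
  move=> j iA jA ij; rewrite !ffunE; have [? _ _ _] := ZP i iA; have [? _ _ _] := ZP j jA.
  by apply: antiS (Yanti i j iA jA ij).
(* Connected minimal subsets of the given sets form a valid family; among all valid families on [A],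
   one of largest total size is taken. *)
pose X := [arg max_(X > finfun Z | valid X) \sum_(i in A) #|X i|].
have [vX maxX] : valid X /\ forall X', valid X' -> \sum_(i in A) #|X' i| <= \sum_(i in A) #|X i|.
  by rewrite /X; case: arg_maxnP.
have [Xconn Xcol1 Xcol Xanti] := validP X vX.
(* Were [x |: X i] colourable with [c.+1] colours, replacing [X i] by it would give a larger valid
   family. *)
have Xmax i x : i \in A -> x \notin X i -> sees x (X i) ->
    {in A, forall j, j != i -> ~~ sees x (X j)} -> ~~ colb e c.+1 (x |: X i).
  move=> iA xi si ns; apply/negP => colx.
  have [a aX xa] := exists_inP si.
  pose X' := [ffun j => if j == i then x |: X i else X j].
  have offx j : j \in A -> j != i -> anti e (x |: X i) (X j).
    move=> jA ji; have aij : anti e (X i) (X j) by apply: Xanti; rewrite // eq_sym.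
    apply: anti_setU1l => // y yX; split; last exact: (seesPn _ _ (ns j jA ji)).
    by apply: contraTneq yX => <-; apply: sees_notin si.
  have vX' : valid X'.
    apply/validP; split=> [j jA|j jA|j jA|j l jA lA jl]; rewrite !ffunE.
    - by case: eqP => _; [exact: (conn_setU1 esym (Xconn i iA) aX xa) | apply: Xconn].
    - by case: eqP => _; [|apply: Xcol1].
    - case: eqP => _; last exact: Xcol.
      by apply: contra (Xcol i iA); apply: colbS; apply: subsetUr.
    - case: (eqVneq j i) jl => [->|ji]; case: (eqVneq l i) => [_|li] jl.
      + by move: jl.
      + exact: offx.
      + by rewrite antiC //; apply: offx.
      + exact: Xanti.
  have := maxX X' vX'; rewrite (bigD1 i) //= [leqRHS](bigD1 i) //= ffunE eqxx.
  rewrite cardsU1 xi; rewrite [X in _ + X <= _](eq_bigr (fun j => #|X j|)) ?leq_add2r ?ltnn //.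
  by move=> j /andP[_ ji]; rewrite ffunE (negPf ji).
pose bad := [set i in A | inhomogeneous X i].
have badA : bad \subset A by apply/subsetP => i; rewrite inE => /andP[].
have cardD : #|A| = #|bad| + #|A :\: bad| by rewrite -(cardsID bad A) (setIidPr badA).
(* The two summands of [packing_factor] pay for the two cases: [3 * m] inhomogeneous members
   suffice, and otherwise enough homogeneous ones remain. *)
have [many|few] := leqP (3 * m) #|bad|.
  apply: (@inhomogeneous_packing c I A X x0 Xanti Xconn Xcol Xmax m bad badA _ many).
  by move=> i; rewrite inE => /andP[].
have good : (2 * k.+1).+1 * k.+1 * m <= #|A :\: bad|.
  by move: cardA; rewrite cardD /packing_factor; lia.
apply: (@homogeneous_packing c I A X x0 Xanti Xcol k m (A :\: bad)) => //.
- exact: subsetDl.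
- by move=> i; rewrite !inE => /andP[+ iA]; rewrite iA.
- by apply: leq_trans good; nia.
Qed.

(** A colour class of a [k.+1]-colouring gives singletons to start from, and [k] steps leave two
    anticomplete sets that are not [k]-colourable. One of them avoids a vertex of the other,
    contrary to criticality. *)
Lemma critical_card k :
  ~~ colb e k [set: T] -> (forall v, colb e k [set~ v]) ->
  #|T| <= k.+1 * (packing_factor k ^ k * 2).
Proof.
move=> nT cT; rewrite leqNgt; apply/negP => big.
have [x0 _] : exists x0, x0 \in [set: T].
  by apply/set0Pn; rewrite -(colb0 e); apply: contra nT; apply: colb_leq.
have colT : colb e k.+1 [set: T].
  by rewrite -(setUCr [set x0]); apply: colb_setU1.
have pack0 : packing (packing_factor k ^ k * 2) 0.
  have [B [_ cardB indB]] := independent_selection [set: T] id colT.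
  exists T, B, set1; split.
  - by rewrite -(leq_pmul2l (isT : 0 < k.+1)); move: cardB; rewrite cardsT; lia.
  - move=> x y xB yB xy; apply/antiP => a b /set1P-> /set1P->.
    by split=> //; apply: indB.
  - by move=> x _; rewrite colb0; apply/set0Pn; exists x; rewrite inE.
have iter n c m : 0 < m -> packing (packing_factor k ^ n * m) c -> packing m (c + n).
  elim: n c m => [|n IH] c m m0; first by rewrite mul1n addn0.
  rewrite expnSr -mulnA addnS => /IH p; apply: (packing_step nT cT m0); apply: p.
  by rewrite muln_gt0 m0.
have [I [A [X [A2 Xanti Xcol]]]] := iter k 0 2 isT pack0.
rewrite add0n in Xcol.
have /card_gt1P[i [j [iA jA ij]]] : 1 < #|A| by [].
have /set0Pn[v vX] : X j != set0.
  by rewrite -(colb0 e); apply: contra (Xcol j jA); apply: colb_leq.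
case/negP: (Xcol i iA); apply: colbS (cT v); apply/subsetP => x xX; rewrite !inE.
by case: (antiP _ _ _ (Xanti i j iA jA ij) x v xX vX).
Qed.

End Packing.

(** * From chromatic numbers to colourability *)

Section ChromaticNumber.
Variables (T : finType) (e : rel T).
Hypothesis eirr : irreflexive e.

Lemma bigminn_leq (I : eqType) (r : seq I) (P : pred I) (F : I -> nat) n i :
  i \in r -> P i -> \big[minn/n]_(j <- r | P j) F j <= F i.
Proof.
elim: r => // j r IH; rewrite inE big_cons => /predU1P[-> Pj|ir Pi].
  by rewrite Pj geq_minl.
by case: ifP => _; [apply: leq_trans (geq_minr _ _) _ |]; apply: IH.
Qed.

Lemma chi_on_leq k (A : {set T}) : (chi_on e A <= k) = colb e k A.
Proof.
apply/idP/idP => [chik|colk].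
  (* Colourability passes to the minimum: the default [#|A|] is realised by the injective colouring
     through [enum A], and each index of the minimum by its own colouring. *)
  apply: colb_leq chik _; rewrite /chi_on; apply: (big_ind (fun n => colb e n A)).
  - apply/colbP; exists (fun x => index x (enum A)); split=> [x xA|x y xA yA exy].
      by rewrite cardE index_mem mem_enum.
    apply: contraTneq exy => /(congr1 (nth x (enum A))).
    by rewrite !nth_index ?mem_enum // => ->; rewrite eirr.
  - by move=> a b ca cb; rewrite /minn; case: ifP.
  - move=> i /existsP[f /forall_inP fP]; apply/colbP; exists (fun x => f x : nat).
    split=> // x y xA yA exy.
    by have /forall_inP/(_ y yA)/implyP/(_ exy) := fP x xA.
have [kA|Ak] := ltnP k #|A|; last first.
  apply: leq_trans Ak; rewrite /chi_on.
  by elim/big_rec: _ => // i n _ H; apply: leq_trans (geq_minr _ _) H.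
(* A colouring into ['I_k] must also be defined outside [A], so the colour type has to be
   inhabited. *)
have k0 : 0 < k.
  rewrite lt0n; apply: contraTneq colk => k0; rewrite k0 colb0 -card_gt0.
  exact: leq_trans kA.
apply: (@bigminn_leq _ _ _ _ _ (Ordinal (ltnW kA : k < #|A|.+1))).
  by rewrite mem_index_enum.
rewrite /=; case: k k0 {kA} colk => // k _ /colbP[f [fk fP]]; apply/existsP.
exists [ffun x => inord (f x)]; apply/forall_inP => x xA; apply/forall_inP => y yA.
apply/implyP => exy; rewrite !ffunE -val_eqE /= !inordK ?fk //.
exact: fP.
Qed.

Lemma vertex_critical_colb k : vertex_critical k.+1 e ->
  ~~ colb e k [set: T] /\ forall v, colb e k [set~ v].
Proof.
move=> [chik crit]; rewrite -chi_on_leq -/(chi e) chik ltnn; split=> // v.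
by rewrite -chi_on_leq -ltnS; apply: crit.
Qed.

End ChromaticNumber.

(* Finitely many isomorphism classes: there is a finite list G 0, ..., G (N-1)
   of graphs such that every 5-vertex-critical (P5, chair)-free graph is
   isomorphic to one of them. *)
Theorem theorem1p3 :
  exists (N : nat) (G : nat -> {n : nat & rel 'I_n}),
    forall (T : finType) (e : rel T),
      simple_graph e ->
      H_free (path_rel 5) e ->
      H_free chair_rel e ->
      vertex_critical 5 e ->
      exists i, i < N /\ graph_iso (projT2 (G i)) e.
Proof.
have [N [G GP]] := bounded_graphs_finite (5 * (packing_factor 4 ^ 4 * 2)).
exists N, G => T e [esym eirr] P5free chairfree /(vertex_critical_colb eirr)[nT cT].
exact/GP/critical_card.
Qed.
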